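(* Let $\mathcal{A}$ be a reproducing kernel Hilbert space with reproducing kernel $\mathbf{k}_z(\cdot)$. Then the set of all Toeplitz operators $T_{G,\Phi}$ on $\mathcal{A}$, where $X$ ranges over all complex linear topological spaces, $G$ over all continuous $X$-valued sesquilinear forms on $\mathcal{A}$, and $\Phi$ over all elements of the dual space $X'$, is a $^*$-algebra (under the usual addition, scalar multiplication, composition and Hilbert space adjoint of operators on $\mathcal{A}$).
   Context: $\mathcal{A}$ is a Hilbert space of functions on a domain $\Omega\subseteq\mathbb{R}^d$ or $\Omega\subseteq\mathbb{C}^d$ (a closed subspace of a Hilbert space $\mathcal{H}$ of functions on $\Omega$) such that every evaluation functional $f\mapsto f(z)$, $z\in\Omega$, is well defined and bounded on $\mathcal{A}$; $\mathbf{k}_z\in\mathcal{A}$ is the element with $f(z)=\langle f,\mathbf{k}_z\rangle$ for all $f\in\mathcal{A}$. Let $X$ be a complex linear topological space (not necessarily complete), $X'$ its dual space (all continuous linear functionals on $X$), and write $\Phi(\phi)=(\Phi,\phi)$ for $\Phi\in X'$, $\phi\in X$. A continuous $X$-valued sesquilinear form on $\mathcal{A}$ is a continuous mapping $G:\mathcal{A}\oplus\mathcal{A}\to X$ that is linear in the first argument and anti-linear in the second. Given such $G$ and $\Phi\in X'$, define the (bounded) sesquilinear form $F_{G,\Phi}(f,g)=(\Phi,G(f,g))$ on $\mathcal{A}$ and the (bounded) Toeplitz operator $$(T_{G,\Phi}f)(z)=F_{G,\Phi}(f,\mathbf{k}_z)=(\Phi,G(f,\mathbf{k}_z)),\qquad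 f\in\mathcal{A},\ z\in\Omega .$$ *)

(* Defs.v *)
From HB Require Import structures.
From mathcomp Require Import all_boot all_order all_algebra.
From mathcomp Require Import complex.
From mathcomp Require Import all_classical all_reals all_analysis.

Set Implicit Arguments.
Unset Strict Implicit.
Unset Printing Implicit Defensive.

Import Order.TTheory GRing.Theory Num.Theory.
Import numFieldNormedType.Exports.

Local Open Scope classical_set_scope.
Local Open Scope ring_scope.
Local Open Scope complex_scope.

(* ['rV[coord_field R b]_d] is R^d for [b = false] and C^d for [b = true]. *)
Definition coord_field (R : realType) (b : bool) : numFieldType :=
  if b then (R[i] : numFieldType) else (R : numFieldType).

Definition domain (T : topologicalType) (Omega : set T) : Prop :=
  [/\ open Omega, connected Omega & Omega !=set0].

(* The norm of a [normedModType R[i]] is [R[i]]-valued, with nonnegative real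
   values.  Linearity is in the first argument of [ip], by [{dot A for Num.conj}];
   completeness is part of [completeNormedModType]. *)
Definition hilbert_inner_product (R : realType) (A : completeNormedModType R[i])
    (ip : {dot A for Num.conj}) : Prop :=
  forall f : A, `|f| ^+ 2 = ip f f.

(* [A] is a Hilbert space of functions on the set [Omega]: [ev f] is the
   function on [Omega] that the element [f] of [A] is, hence the injectivity.
   [k z] is the reproducing kernel at [z]. *)
Record rkhs (R : realType) (V : Type) (Omega : set V)
    (A : completeNormedModType R[i]) (ip : {dot A for Num.conj})
    (ev : {linear A -> (Omega -> R[i]^o)}) (k : Omega -> A) : Prop := {
  rkhs_ip : hilbert_inner_product ip ;
  rkhs_ev_inj : injective ev ;
  rkhs_ev_bounded : forall z : Omega,
    exists M : R, forall f : A, `|ev f z| <= M%:C * `|f| ;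
  rkhs_kernel : forall (f : A) (z : Omega), ev f z = ip f (k z)
}.

(* Linear in the first argument, anti-linear in the second. *)
Definition sesquilinear_form (R : realType) (A : completeNormedModType R[i])
    (X : topologicalLmodType R[i]) : Type :=
  {bilinear A -> A -> X | *:%R & (@Num.conj R[i]) \; *:%R}.

Definition continuous_form (R : realType) (A : completeNormedModType R[i])
    (X : topologicalLmodType R[i]) (G : sesquilinear_form A X) : Prop :=
  continuous (fun p : A * A => G p.1 p.2).

Definition dual_space (R : realType) (X : topologicalLmodType R[i]) :
  set {linear X -> R[i]^o} := [set Phi | continuous Phi].

Definition toeplitz (R : realType) (V : Type) (Omega : set V)
    (A : completeNormedModType R[i]) (k : Omega -> A)
    (X : topologicalLmodType R[i]) (G : sesquilinear_form A X)
    (Phi : {linear X -> R[i]^o}) (f : A) : Omega -> R[i]^o :=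
  fun z => Phi (G f (k z)).

Definition is_toeplitz (R : realType) (V : Type) (Omega : set V)
    (A : completeNormedModType R[i]) (ev : A -> Omega -> R[i]^o)
    (k : Omega -> A) (X : topologicalLmodType R[i])
    (G : sesquilinear_form A X) (Phi : {linear X -> R[i]^o})
    (T : A -> A) : Prop :=
  forall (f : A) (z : Omega), ev (T f) z = toeplitz k G Phi f z.

Definition toeplitz_operators (R : realType) (V : Type) (Omega : set V)
    (A : completeNormedModType R[i]) (ev : A -> Omega -> R[i]^o)
    (k : Omega -> A) : set (A -> A) :=
  [set T | exists (X : topologicalLmodType R[i]) (G : sesquilinear_form A X)
             (Phi : {linear X -> R[i]^o}),
    [/\ continuous_form G, dual_space Phi & is_toeplitz ev k G Phi T]].

Definition bounded_operator (R : realType) (A : completeNormedModType R[i]) :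
  set (A -> A) :=
  [set T | linear T /\ exists M : R, forall f : A, `|T f| <= M%:C * `|f|].

Definition adjoint (R : realType) (A : completeNormedModType R[i])
    (ip : {dot A for Num.conj}) (T T' : A -> A) : Prop :=
  forall f g : A, ip (T f) g = ip f (T' g).

(* A *-algebra of operators, not assumed to contain the identity.  The algebra
   and involution identities are inherited from the bounded operators; the
   adjoint of [T] is unique because [ip] is definite. *)
Record star_algebra (R : realType) (A : completeNormedModType R[i])
    (ip : {dot A for Num.conj}) (S : set (A -> A)) : Prop := {
  star_bounded : S `<=` @bounded_operator R A ;
  star_zero : S (fun=> 0) ;
  star_add : forall T1 T2, S T1 -> S T2 -> S (T1 \+ T2) ;
  star_scale : forall (a : R[i]) T, S T -> S (a \*: T) ;
  star_comp : forall T1 T2, S T1 -> S T2 -> S (T1 \o T2) ;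
  star_adjoint : forall T, S T -> exists2 T', adjoint ip T T' & S T'
}.

(* Main.v *)
Require Import Defs.
From HB Require Import structures.
From mathcomp Require Import all_boot all_order all_algebra.
From mathcomp Require Import complex.
From mathcomp Require Import all_classical all_reals all_analysis.
From mathcomp Require Import ring.

Set Implicit Arguments.
Unset Strict Implicit.
Unset Printing Implicit Defensive.

Import Order.TTheory GRing.Theory Num.Theory.
Import numFieldNormedType.Exports.

Local Open Scope classical_set_scope.
Local Open Scope ring_scope.
Local Open Scope complex_scope.

(** The Toeplitz operators are exactly the bounded operators of the Hilbert
    space [A], and these form a star-algebra.

    Every Toeplitz operator is bounded.  If [G] is a continuous [X]-valued
    sesquilinear form and [Phi] a continuous functional on [X], then [Phi \o G]
    is a continuous sesquilinear form on [A] with complex values.  Such a form is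
    bounded by rescaling a neighbourhood of the origin
    ([continuous_form_bounded]), so the Riesz theorem ([riesz_bounded_form])
    writes it as [(f, g) |-> ip (T f) g] with [T] bounded.  Putting [g = k z] and
    using the reproducing property, [ev (T f) z] is [Phi (G f (k z))], and since
    [ev] is injective no other operator has these Toeplitz data.

    Conversely a bounded operator [T] is the Toeplitz operator of the scalar form
    [(f, g) |-> ip (T f) g] and the identity functional
    ([bounded_operator_toeplitz]).

    So the theorem reduces to the stability of bounded operators under the
    algebraic operations and the adjoint ([bounded_operators_star_algebra]); the
    adjoint is again given by the Riesz theorem.  The latter is proved
    variationally: approximate minimizers of [`|y| ^+ 2 - 2 Re (phi y)] represent
    the functional [phi] approximately ([almost_riesz_representation]), they form
    a Cauchy sequence, and completeness provides the limit. *)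

(** * Inner products *)

(** The component of [u] orthogonal to [v] has nonnegative square. *)
Lemma dot_CauchySchwarz (C : numClosedFieldType) (U : lmodType C)
    (form : {dot U for Num.conj}) (u v : U) :
  `|form u v| ^+ 2 <= form u u * form v v.
Proof.
have [->|v0] := eqVneq v 0; first by rewrite !linear0r normr0 expr0n.
have v_gt0 : 0 < form v v by rewrite dnorm_gt0.
have := dnorm_ge0 form (u - (form u v / form v v) *: v).
rewrite dnormB dnormZ linearZr_LR/= normrM normfV (gtr0_norm v_gt0).
rewrite rmorphM/= fmorphV/= (geC0_conj (ltW v_gt0)).
rewrite (mulrAC (Num.conj _)) (mulrC (Num.conj (form u v))) -normCK.
rewrite rmorphM fmorphV/= (geC0_conj (ltW v_gt0)).
rewrite geC0_conj ?exprn_ge0// exprMn expr2 (expr2 _^-1) mulrA mulfVK ?gt_eqF//.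
by rewrite opprD addrA addrK subr_ge0 ler_pdivrMr.
Qed.

(** * The Riesz representation theorem *)

(** Being above the real number [m] makes every value of [J] real, so that the
    infimum can be taken among real parts. *)
Lemma exists_almost_minimizer (R : realType) (T : pointedType)
    (J : T -> R[i]) (m e : R) :
  (forall x, m%:C <= J x) -> 0 < e ->
  exists x, forall y, J x <= J y + e%:C.
Proof.
move=> mJ e0; pose S := [set complex.Re (J x) | x in setT].
have Sinf : has_inf S.
  split; first by exists (complex.Re (J point)), point.
  by exists m => _ [x _ <-]; have := mJ x; rewrite lecE => /andP[].
have [_ [x _ <-] xlt] := inf_adherent e0 Sinf.
have ImJ y : complex.Im (J y) = 0 by have := mJ y; rewrite lecE => /andP[/eqP].
exists x => y; rewrite lecE; apply/andP; split.
  by rewrite raddfD/= !ImJ addr0.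
rewrite raddfD/= (le_trans (ltW xlt))// lerD2r.
by apply: ge_inf; [case: Sinf | exists y].
Qed.

Section riesz.
Context (R : realType) (A : completeNormedModType R[i])
  (ip : {dot A for Num.conj}) (ip_norm : hilbert_inner_product ip).

Lemma hilbert_CauchySchwarz (f g : A) : `|ip f g| <= `|f| * `|g|.
Proof.
rewrite -(@ler_pXn2r _ 2) ?nnegrE ?mulr_ge0// exprMn !ip_norm.
exact: dot_CauchySchwarz.
Qed.

Lemma dot_ext (f g : A) : (forall h, ip f h = ip g h) -> f = g.
Proof.
move=> fg; apply/eqP; rewrite -subr_eq0 -(dnorm_eq0 ip).
by rewrite linearBl/= fg subrr.
Qed.

(** Scaling optimizes a quadratic inequality into a norm bound: replacing [h] by
    [t *: h] with [t = (D h)^* / `|h| ^+ 2] turns the hypothesis into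
    [2 a ^+ 2 / n ^+ 2 <= a ^+ 2 / n ^+ 2 + e ^+ 2], where [a = `|D h|] and
    [n = `|h|]. *)
Lemma scalable_norm_le (D : A -> R[i]) (e : R[i]) :
  (forall a h, D (a *: h) = a * D h) -> 0 <= e ->
  (forall h, D h + Num.conj (D h) <= `|h| ^+ 2 + e ^+ 2) ->
  forall h, `|D h| <= e * `|h|.
Proof.
move=> DZ e0 De h; have [->|h0] := eqVneq h 0.
  by rewrite -(scale0r 0) DZ mul0r normr0 mulr_ge0.
have n0 : 0 < `|h| ^+ 2 by rewrite exprn_gt0// normr_gt0.
have := De ((Num.conj (D h) / `|h| ^+ 2) *: h).
rewrite DZ mulrAC (mulrC (Num.conj _)) -normCK geC0_conj; last first.
  by rewrite divr_ge0// exprn_ge0.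
rewrite normrZ normrM norm_conjC normfV (gtr0_norm n0).
rewrite (_ : (`|D h| / `|h| ^+ 2 * `|h|) ^+ 2 = `|D h| ^+ 2 / `|h| ^+ 2); last first.
  by field; rewrite normr_eq0.
by rewrite lerD2l ler_pdivrMr// -exprMn ler_pXn2r ?nnegrE ?mulr_ge0.
Qed.

Lemma addCJ_le_norm (z : R[i]) : z + Num.conj z <= `|z| *+ 2.
Proof.
apply: le_trans (real_ler_norm _) _.
  by apply/CrealP; rewrite rmorphD/= conjCK addrC.
by rewrite (le_trans (ler_normD _ _))// norm_conjC mulr2n.
Qed.

Section functional.
Context (phi : A -> R[i]) (phi_lin : scalar phi) (M : R)
  (phi_bounded : forall f, `|phi f| <= M%:C * `|f|).

Let phiD f g : phi (f + g) = phi f + phi g.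
Proof. by have := phi_lin 1 f g; rewrite scale1r mul1r. Qed.

Let phiZ a f : phi (a *: f) = a * phi f.
Proof. exact: (scalable_linear phi_lin). Qed.

(** The vector representing [phi] is the minimizer of
    [J y = `|y| ^+ 2 - 2 Re (phi y)], which is bounded below by [- M ^+ 2].
    A vector [x] at which [J] is minimal up to [e ^+ 2] satisfies
    [2 Re (phi h - ip h x) <= `|h| ^+ 2 + e ^+ 2] for all [h], by expansion of
    [J (x + h)]; so it represents [phi] up to an error of norm [e]. *)
Lemma almost_riesz_representation (e : R[i]) : 0 < e ->
  exists x, forall h, `|phi h - ip h x| <= e * `|h|.
Proof.
move=> e0; have eE : (complex.Re e)%:C = e by rewrite RRe_real// gtr0_real.
pose J y : R[i] := `|y| ^+ 2 - (phi y + Num.conj (phi y)).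
have Jlb y : (- M ^+ 2)%:C <= J y.
  rewrite rmorphN rmorphXn/= lerBrDr addrC lerBlDr.
  apply: le_trans (addCJ_le_norm _) _.
  apply: (@le_trans _ _ ((M%:C * `|y|) *+ 2)); first by rewrite lerMn2r phi_bounded.
  rewrite -subr_ge0 (_ : _ - _ = (`|y| - M%:C) ^+ 2); last by ring.
  rewrite real_exprn_even_ge0// rpredB// ?normr_real//.
  by apply/complex_realP; exists M.
have e2 : 0 < complex.Re e ^+ 2 by rewrite exprn_gt0// -ltcR eE.
have [x xmin] := exists_almost_minimizer Jlb e2.
exists x => h; apply: (@scalable_norm_le (fun h => phi h - ip h x)) (ltW e0) _ h.
  by move=> a h; rewrite phiZ linearZl_LR mulrBr.
move=> h; have := xmin (x + h).
rewrite rmorphXn/= eE /J !ip_norm dnormD phiD !rmorphD/= rmorphN/=.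
rewrite [ip x h]hermC/= mul1r conjCK -subr_ge0 => le0; rewrite -subr_ge0.
by apply: le_trans le0 _; rewrite le_eqVlt; apply/orP; left; apply/eqP; ring.
Qed.

(** Two vectors that represent [phi] up to errors [e] and [e'] are within
    [e + e'] of each other.  Hence approximate representers with vanishing errors
    form a Cauchy sequence, and their limit represents [phi]. *)
Theorem riesz_representation : exists x, forall h, phi h = ip h x.
Proof.
have inv_gt0 n : 0 < n.+1%:R^-1 :> R[i] by rewrite invr_gt0.
have [x_ x_le] := choice (fun n => almost_riesz_representation (inv_gt0 n)).
have small (e : R[i]) : 0 < e ->
    \forall n \near \oo, n.+1%:R^-1 < e.
  move=> e0; have eE : (complex.Re e)%:C = e by rewrite RRe_real// gtr0_real.
  have Re0 : 0 < complex.Re e by rewrite -ltcR eE.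
  near=> n; rewrite -eE -(rmorph_nat (real_complex R)) -fmorphV ltcR.
  by near: n; exact: (near_infty_natSinv_lt (PosNum Re0)).
have x_dist m n : `|x_ m - x_ n| <= m.+1%:R^-1 + n.+1%:R^-1.
  (* Test the two approximations against the difference itself. *)
  set h := x_ m - x_ n; have [->|h0] := eqVneq h 0.
    by rewrite normr0 addr_ge0// ltW.
  rewrite -(@ler_pM2r _ `|h|) ?normr_gt0// -expr2 ip_norm {2}/h linearBr/=.
  rewrite -[X in X <= _]ger0_norm; last first.
    by rewrite -linearBr; exact: dnorm_ge0.
  rewrite (_ : _ - _ = (phi h - ip h (x_ n)) - (phi h - ip h (x_ m))); last by ring.
  by rewrite (le_trans (ler_normB _ _))// mulrDl addrC lerD.
have x_cauchy : cauchy (x_ n @[n --> \oo]).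
  apply: cauchy_exP => e e0.
  have [N _ HN] := small (e / 2) (divr_gt0 e0 (ltr0Sn _ 1)).
  exists (x_ N); exists N => // n /= Nn; rewrite -ball_normE/=.
  rewrite (le_lt_trans (x_dist _ _))// [e]splitr ltrD//.
    exact: (HN N (leqnn N)).
  exact: (HN n Nn).
have /cauchy_cvg x_cvg := x_cauchy.
set x := lim _ in x_cvg.
exists x => h; apply/eqP; rewrite -subr_eq0 -normr_le0.
apply/ler_addgt0Pr => e e0; rewrite add0r.
(* Adding [1] keeps the denominator positive when [h = 0]. *)
pose c := e / 2 / (`|h| + 1).
have h1 : 0 < `|h| + 1 by rewrite ltr_wpDl.
have c0 : 0 < c by rewrite !divr_gt0.
near \oo => n.
rewrite (_ : phi h - _ = (phi h - ip h (x_ n)) + ip h (x_ n - x)); last first.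
  by rewrite linearBr/=; ring.
rewrite (le_trans (ler_normD _ _))// [e]splitr lerD//.
  apply: (le_trans (x_le _ _)).
  apply: (@le_trans _ _ (c * (`|h| + 1))); last by rewrite divfK ?gt_eqF.
  rewrite ler_pM ?lerDl// ltW//; near: n; exact: small.
apply: (le_trans (hilbert_CauchySchwarz _ _)).
apply: (@le_trans _ _ ((`|h| + 1) * c)); last by rewrite mulrC divfK ?gt_eqF.
rewrite ler_pM ?lerDl// distrC ltW//; near: n.
exact: (cvgr_dist_lt _ _ x_cvg).
Unshelve. all: by end_near. Qed.

End functional.

(** For fixed [f], the functional [g |-> (F f g)^*] is linear and bounded; [T f]
    is its representer. *)
Theorem riesz_bounded_form (F : A -> A -> R[i]) (M : R) :
  (forall g, scalar (F^~ g)) ->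
  (forall f, scalar (fun g => Num.conj (F f g))) ->
  0 <= M -> (forall f g, `|F f g| <= M%:C * (`|f| * `|g|)) ->
  exists2 T, bounded_operator T & forall f g, F f g = ip (T f) g.
Proof.
move=> Fl Fr M0 FM.
have rep f : exists x, forall g, Num.conj (F f g) = ip g x.
  apply: (@riesz_representation _ (Fr f) (M * complex.Re `|f|)) => g.
  rewrite norm_conjC (le_trans (FM _ _))// rmorphM/= RRe_real ?normr_real//.
  by rewrite mulrA.
have [T HT] := choice rep.
have FT f g : F f g = ip (T f) g.
  by rewrite [RHS]hermC/= mul1r -HT conjCK.
exists T => //; split.
  move=> a f g; apply: dot_ext => h.
  by rewrite linearPl/= -!FT Fl.
exists M => f; have [->|Tf0] := eqVneq (T f) 0.
  by rewrite normr0 mulr_ge0 ?ler0c.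
rewrite -(@ler_pM2r _ `|T f|) ?normr_gt0// -expr2 ip_norm -FT -mulrA.
by rewrite -[X in X <= _]ger0_norm ?FM// FT.
Qed.

End riesz.

(** * Continuity and boundedness *)

(** Continuity at the origin bounds [F] by [1] on the product of two balls of
    radius larger than [r]; sesquilinearity rescales any pair of nonzero vectors
    to that product, with constant [r ^- 2]. *)
Lemma continuous_form_bounded (R : realType) (A : completeNormedModType R[i])
    (F : A -> A -> R[i]^o) :
  (forall a f g, F (a *: f) g = a * F f g) ->
  (forall a f g, F f (a *: g) = Num.conj a * F f g) ->
  {for 0, continuous (fun p : A * A => F p.1 p.2)} ->
  exists2 M : R, 0 <= M & forall f g, `|F f g| <= M%:C * (`|f| * `|g|).
Proof.
move=> Fl Fr Fc.
have F0l g : F 0 g = 0 by rewrite -(scale0r 0) Fl mul0r.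
have F0r f : F f 0 = 0 by rewrite -(scale0r 0) Fr rmorph0 mul0r.
have /nbhs_ballP[d /= d0 Fd] :
    \forall p \near (0 : A * A), `|F p.1 p.2| < 1.
  have /cvgrPdist_lt/(_ 1 ltr01) := Fc.
  by apply: filterS => p /=; rewrite F0l sub0r normrN.
have [r r0 rd] : exists2 r, 0 < r & r < d.
  by exists (d / 2); rewrite ?divr_gt0// [ltRHS]splitr ltrDl divr_gt0.
have rM : (complex.Re (r ^- 2))%:C = r ^- 2.
  by rewrite RRe_real// gtr0_real// invr_gt0 exprn_gt0.
exists (complex.Re (r ^- 2)) => [|f g].
  by rewrite -ler0c rM invr_ge0 exprn_ge0// ltW.
rewrite rM; have [->|f0] := eqVneq f 0; first by rewrite F0l !normr0 mul0r mulr0.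
have [->|g0] := eqVneq g 0; first by rewrite F0r !normr0 !mulr0.
have nf : 0 < `|f| by rewrite normr_gt0.
have ng : 0 < `|g| by rewrite normr_gt0.
have nrm h : 0 < `|h| -> `|(r / `|h|) *: h| = r.
  by move=> h0; rewrite normrZ gtr0_norm ?divr_gt0// divfK ?gt_eqF.
have : `|F ((r / `|f|) *: f) ((r / `|g|) *: g)| < 1.
  by apply: (Fd (_, _)); split; rewrite /= -ball_normE /= sub0r normrN nrm.
rewrite Fl Fr normrM (normrM (Num.conj _)) norm_conjC !normrM.
rewrite !normfV !normr_id (gtr0_norm r0) => /ltW.
rewrite (_ : _ * (_ * _) = (r ^+ 2 / (`|f| * `|g|)) * `|F f g|); last first.
  by field; rewrite !gt_eqF.
rewrite -ler_pdivlMl ?divr_gt0 ?mulr_gt0 ?exprn_gt0// mulr1 invf_div.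
by rewrite mulrC.
Qed.

Lemma bounded_operator_ge0 (R : realType) (A : completeNormedModType R[i])
    (T : A -> A) : bounded_operator T ->
  linear T /\ exists2 M : R, 0 <= M & forall f, `|T f| <= M%:C * `|f|.
Proof.
move=> [Tlin [M TM]]; split => //; exists `|M| => // f.
by rewrite (le_trans (TM f))// ler_wpM2r// lecR ler_norm.
Qed.

(** * Toeplitz operators *)

(** The adjoint of [T] represents the bounded form [(f, g) |-> ip f (T g)]. *)
Lemma bounded_operators_star_algebra (R : realType)
    (A : completeNormedModType R[i]) (ip : {dot A for Num.conj}) :
  hilbert_inner_product ip -> star_algebra ip (@bounded_operator R A).
Proof.
move=> ip_norm; split => //.
- split=> [a f g|]; first by rewrite scaler0 addr0.
  by exists 0 => f; rewrite normr0 mul0r.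
- move=> T1 T2 [lin1 [M1 TM1]] [lin2 [M2 TM2]]; split=> [a f g|].
    by rewrite /= lin1 lin2 scalerDr addrACA.
  exists (M1 + M2) => f; rewrite (le_trans (ler_normD _ _))//.
  by rewrite rmorphD mulrDl lerD.
- move=> c T [lin [M TM]]; split=> [a f g|].
    by rewrite /= lin scalerDr !scalerA mulrC.
  have /complex_realP[a ca] := normr_real c.
  exists (a * M) => f.
  by rewrite normrZ ca rmorphM/= -mulrA ler_wpM2l// -ca.
- move=> T1 T2 /bounded_operator_ge0[lin1 [M1 M1_ge0 TM1]] [lin2 [M2 TM2]].
  split=> [a f g|]; first by rewrite /= lin2 lin1.
  exists (M1 * M2) => f; rewrite (le_trans (TM1 _))// rmorphM/= -mulrA.
  by rewrite ler_wpM2l ?ler0c.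
- move=> T /bounded_operator_ge0[Tlin [M M0 TM]].
  have [|||T' T'b TT'] :=
      @riesz_bounded_form _ _ _ ip_norm (fun f g => ip f (T g)) M _ _ M0.
  + by move=> g a f1 f2; rewrite linearPl.
  + by move=> f a g1 g2; rewrite Tlin linearPr/= rmorphD rmorphM/= conjCK.
  + move=> f g; rewrite (le_trans (hilbert_CauchySchwarz ip_norm _ _))//.
    by rewrite mulrCA ler_wpM2l.
  exists T' => // f g.
  by rewrite [RHS]hermC/= -TT' [LHS]hermC/=.
Qed.

(** At [(f, g)] the increment splits into [ip (T (u - f)) v] and
    [ip (T f) (v - g)], both small by Cauchy-Schwarz. *)
Lemma dot_comp_continuous (R : realType) (A : completeNormedModType R[i])
    (ip : {dot A for Num.conj}) (T : A -> A) :
  hilbert_inner_product ip -> bounded_operator T ->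
  continuous (fun p : A * A => ip (T p.1) p.2 : R[i]^o).
Proof.
move=> ip_norm [Tlin [M TM]] [f g]; apply/cvgrPdist_lt => /= e e0.
have TB u v : T (u - v) = T u - T v by exact: (zmod_morphism_linear Tlin).
pose bound (p : A * A) : R[i]^o :=
  M%:C * `|p.1 - f| * `|p.2| + `|T f| * `|p.2 - g|.
have bound0 : bound p @[p --> (f, g)] --> (0 : R[i]^o).
  rewrite (_ : 0 = bound (f, g)); last by rewrite /bound/= !subrr !normr0; ring.
  apply: cvgD; apply: cvgM.
  - apply: cvgM; first exact: cvg_cst.
    by apply: cvg_norm; apply: cvgB; [exact: cvg_fst|exact: cvg_cst].
  - by apply: cvg_norm; exact: cvg_snd.
  - exact: cvg_cst.
  - by apply: cvg_norm; apply: cvgB; [exact: cvg_snd|exact: cvg_cst].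
have /cvgr0_norm_lt/(_ _ e0) := bound0; apply: filterS => p; apply: le_lt_trans.
rewrite distrC (_ : _ - _ = ip (T (p.1 - f)) p.2 + ip (T f) (p.2 - g)); last first.
  by rewrite TB linearBl linearBr/=; ring.
apply: le_trans (real_ler_norm _); last first.
  by rewrite rpredD ?rpredM// ?normr_real//; apply/complex_realP; exists M.
rewrite (le_trans (ler_normD _ _))// lerD//.
  by rewrite (le_trans (hilbert_CauchySchwarz ip_norm _ _))// ler_wpM2r.
exact: hilbert_CauchySchwarz.
Qed.

Section toeplitz.
Context (R : realType) (V : Type) (Omega : set V)
    (A : completeNormedModType R[i]) (ip : {dot A for Num.conj})
    (ev : {linear A -> (Omega -> R[i]^o)}) (k : Omega -> A)
    (A_rkhs : rkhs ip ev k).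

(** [Phi \o G] is a bounded sesquilinear form, so it is [(f, g) |-> ip (T f) g]
    for a bounded [T]; taking [g = k z] turns this into the identity that
    defines the Toeplitz operator. *)
Lemma form_toeplitz_operator (X : topologicalLmodType R[i])
    (G : sesquilinear_form A X) (Phi : {linear X -> R[i]^o}) :
  continuous_form G -> dual_space Phi ->
  exists2 T : A -> A, bounded_operator T & is_toeplitz ev k G Phi T.
Proof.
move=> Gc Phic; pose F f g : R[i]^o := Phi (G f g).
have Fl g : scalar (F^~ g).
  by move=> a f1 f2; rewrite /F linearPl linearP.
have Fr f : scalar (fun g => Num.conj (F f g)).
  move=> a g1 g2; rewrite /F linearPr/= linearP/= rmorphD rmorphM/=.
  by rewrite conjCK.
have Fc : continuous (fun p : A * A => F p.1 p.2).
  move=> p; apply: (@continuous_comp _ _ _ (fun p : A * A => G p.1 p.2) Phi).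
    exact: Gc.
  exact: Phic.
have [M M0 FM] : exists2 M : R, 0 <= M &
    forall f g, `|F f g| <= M%:C * (`|f| * `|g|).
  apply: continuous_form_bounded; last exact: Fc.
    by move=> a f g; exact: (scalable_linear (Fl g)).
  move=> a f g; rewrite -[LHS]conjCK (scalable_linear (Fr f))/=.
  by rewrite rmorphM/= conjCK.
have [T Tb TF] := riesz_bounded_form (rkhs_ip A_rkhs) Fl Fr M0 FM.
by exists T => // f z; rewrite (rkhs_kernel A_rkhs) -TF.
Qed.

(** A bounded operator comes from scalar data: [X] is the field of scalars, [G]
    is the form [(f, g) |-> ip (T f) g] and [Phi] is the identity. *)
Lemma bounded_operator_toeplitz (T : A -> A) :
  bounded_operator T -> toeplitz_operators ev k T.
Proof.
move=> Tb; have [Tlin _] := Tb.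
pose G (f g : A) : R[i]^o := ip (T f) g.
have GP : bilinear_for (GRing.Scale.Law.clone _ _ ( *:%R : R[i] -> R[i]^o -> R[i]^o) _)
   (GRing.Scale.Law.clone _ _ ((@Num.conj R[i]) \; *:%R : R[i] -> R[i]^o -> R[i]^o) _) G.
  split.
    by move=> g a f1 f2; rewrite /G Tlin linearPl.
  by move=> f a g1 g2; rewrite /G linearPr.
pose GB := bilinear_isBilinear.Build _ _ _ _ _ _ G GP.
pose Gf : sesquilinear_form A R[i]^o := HB.pack G GB.
exists R[i]^o, Gf, idfun; split.
- exact: (dot_comp_continuous (rkhs_ip A_rkhs)).
- by move=> ?; exact: cvg_id.
- by move=> f z; rewrite (rkhs_kernel A_rkhs).
Qed.

(** Since [ev] is injective, an operator with the Toeplitz data of [G] and [Phi]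
    is the bounded one that [form_toeplitz_operator] provides. *)
Lemma toeplitz_operatorsE : toeplitz_operators ev k = @bounded_operator R A.
Proof.
apply/seteqP; split => [T [X [G [Phi [Gc Phic TG]]]]|T].
  have [T' T'b T'G] := form_toeplitz_operator Gc Phic.
  suff -> : T = T' by [].
  apply/funext => f; apply: (rkhs_ev_inj A_rkhs); apply/funext => z.
  by rewrite TG T'G.
exact: bounded_operator_toeplitz.
Qed.

End toeplitz.

(* The first conjunct says that each T_{G,Phi} is a well-defined bounded
   operator on A, the second that these operators form a *-algebra. *)
Theorem theorem4p1 (R : realType) (d : nat) (b : bool)
    (Omega : set 'rV[coord_field R b]_d) (Omega_domain : domain Omega)
    (A : completeNormedModType R[i]) (ip : {dot A for Num.conj})
    (ev : {linear A -> (Omega -> R[i]^o)}) (k : Omega -> A)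
    (A_rkhs : rkhs ip ev k) :
  (forall (X : topologicalLmodType R[i]) (G : sesquilinear_form A X)
      (Phi : {linear X -> R[i]^o}),
    continuous_form G -> dual_space Phi ->
    exists2 T : A -> A, bounded_operator T & is_toeplitz ev k G Phi T) /\
  star_algebra ip (toeplitz_operators ev k).
Proof.
split; first by move=> X G Phi; exact: (form_toeplitz_operator A_rkhs).
rewrite (toeplitz_operatorsE A_rkhs).
exact: bounded_operators_star_algebra (rkhs_ip A_rkhs).
Qed.
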